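(* Let $n\geq 2$ and let $H\leq S_n$ be semiregular. Let $R$ be a set of orbit representatives of the natural action of $H$ on $\{1,2,\dots,n\}$ (exactly one point from each orbit), and let $G\leq N_{S_n}(H)\cap \mathrm{Stab}_{S_n}(R)$. Then $HG=\{hg: h\in H, g\in G\}$ is a group (a subgroup of $S_n$), and $V_n(HG)\cong V_n(G)$.
   Context: $S_n$ is the symmetric group on $\{1,2,\dots,n\}$, acting on the right ($i\cdot g$ is the image of $i$ under $g$); all maps are composed from left to right. A subgroup $H\leq S_n$ is semiregular if no non-trivial element of $H$ fixes a point of $\{1,\dots,n\}$. $N_{S_n}(H)$ is the normalizer of $H$ in $S_n$, and $\mathrm{Stab}_{S_n}(R)$ is the setwise (not pointwise) stabilizer of $R$ in $S_n$. Let $\mathfrak{C}_n=\{1,2,\dots,n\}^{\omega}$ be the space of infinite words over $\{1,\dots,n\}$ with the product topology. For a finite word $\theta\in\{1,\dots,n\}^*$ (possibly empty), the cone of $\theta$ is $[\theta]=\{\theta u: u\in\{1,\dots,n\}^\omega\}\subset\mathfrak{C}_n$. The Higman-Thompson group $V_n$ is the group of all homeomorphisms $v$ of $\mathfrak{C}_n$ for which there are two partitions of $\mathfrak{C}_n$ into the same finite number $t$ of cones, $[\alpha_1],\dots,[\alpha_t]$ and $[\beta_1],\dots,[\beta_t]$, such that $(\alpha_i\gamma)\cdot v=\beta_i\gamma$ for all $i$ and all $\gamma\in\{1,\dots,n\}^\omega$. For $g\in S_n$ and a finite word $\alpha$, the iterated permutation $[\alpha]_g$ is the homeomorphism of $\mathfrak{C}_n$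 that is the identity outside $[\alpha]$ and satisfies $(\alpha b_1b_2b_3\dots)\cdot[\alpha]_g=\alpha(b_1\cdot g)(b_2\cdot g)(b_3\cdot g)\dots$ for all $b_1b_2b_3\dots\in\mathfrak{C}_n$. For $K\leq S_n$, $V_n(K)$ is the group of homeomorphisms of $\mathfrak{C}_n$ generated by $V_n$ together with all $[\alpha]_g$ with $g\in K$ and $\alpha\in\{1,\dots,n\}^*$. *)

(* Defs.v *)
From HB Require Import structures.
From mathcomp Require Import all_boot all_order all_algebra all_fingroup.
From mathcomp Require Import mathcomp_extra boolp classical_sets functions.
From mathcomp Require Import topology function_spaces.

Set Implicit Arguments.
Unset Strict Implicit.
Unset Printing Implicit Defensive.

Local Open Scope classical_set_scope.
Local Open Scope group_scope.

Section Homeo.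
Variable X : topologicalType.

Record homeo := Homeo {
  homeo_fun :> X -> X;
  homeo_inv : X -> X;
  homeo_funK : cancel homeo_fun homeo_inv;
  homeo_invK : cancel homeo_inv homeo_fun;
  homeo_cts : continuous homeo_fun;
  homeo_inv_cts : continuous homeo_inv }.

Lemma homeoP (f g : homeo) : f =1 g -> f = g.
Proof.
case: f g => [f f' fK f'K fc f'c] [g g' gK g'K gc g'c] /= fg.
have e : f = g by apply/funext.
subst g.
have e' : f' = g' by apply/funext => x; rewrite -{1}(g'K x) fK.
subst g'.
by congr Homeo; exact: Prop_irrelevance.
Qed.

HB.instance Definition _ := gen_eqMixin homeo.
HB.instance Definition _ := gen_choiceMixin homeo.

Definition homeo_one : homeo :=
  @Homeo id id (fun=> erefl) (fun=> erefl) (fun=> @cvg_id _ _) (fun=> @cvg_id _ _).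

Definition homeo_inverse (f : homeo) : homeo :=
  Homeo (@homeo_invK f) (@homeo_funK f) (@homeo_inv_cts f) (@homeo_cts f).

(* Maps compose from left to right: (f * g) x = g (f x), as for 'S_n. *)
Definition homeo_mul (f g : homeo) : homeo :=
  @Homeo (g \o f) (homeo_inv f \o homeo_inv g)
    (can_comp (@homeo_funK g) (@homeo_funK f))
    (can_comp (@homeo_invK f) (@homeo_invK g))
    (fun x => continuous_comp (@homeo_cts f x) (@homeo_cts g (f x)))
    (fun x => continuous_comp (@homeo_inv_cts g x)
                              (@homeo_inv_cts f (homeo_inv g x))).

Let homeo_mulA : associative homeo_mul.
Proof. by move=> f g h; apply: homeoP. Qed.
Let homeo_1mul : left_id homeo_one homeo_mul.
Proof. by move=> f; apply: homeoP. Qed.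
Let homeo_mul1 : right_id homeo_one homeo_mul.
Proof. by move=> f; apply: homeoP. Qed.
Let homeo_Vmul : left_inverse homeo_one homeo_inverse homeo_mul.
Proof. by move=> f; apply: homeoP => x /=; rewrite homeo_invK. Qed.
Let homeo_mulV : right_inverse homeo_one homeo_inverse homeo_mul.
Proof. by move=> f; apply: homeoP => x /=; rewrite homeo_funK. Qed.

HB.instance Definition _ := isGroup.Build homeo
  homeo_mulA homeo_1mul homeo_mul1 homeo_Vmul homeo_mulV.

End Homeo.

Section GeneratedSubgroup.
Variables (U : groupType) (S : set U).

Definition gen_set : set U :=
  smallest (fun A : set U => group_closed (fun x => x \in A)) S.

Lemma gen_set_closed : group_closed (fun x => x \in gen_set).
Proof.
split; first by apply/mem_set => A [[A1 _] _]; apply/set_mem.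
move=> f g /set_mem fS /set_mem gS; apply/mem_set => A AS.
have [[_ Adiv] _] := AS.
by apply/set_mem/Adiv; apply/mem_set; [exact: fS | exact: gS].
Qed.

Definition gen_subgroup : Type := {f : U | f \in gen_set}.

HB.instance Definition _ := SubChoice.on gen_subgroup.
HB.instance Definition _ :=
  SubChoice_isSubGroup.Build U (fun x => x \in gen_set) gen_subgroup
    gen_set_closed.

End GeneratedSubgroup.

(* The alphabet {1, ..., n} is encoded as 'I_n = {0, ..., n-1}. *)
Notation cantor n := {ptws nat -> discrete_topology 'I_n}.

Section Cantor.
Variable n : nat.
Implicit Types (w : seq 'I_n) (g : 'S_n) (x u : cantor n).

(* The default value of [nth] is reached exactly for indices k >= size w. *)
Definition catw w u : cantor n := fun k => nth (u (k - size w)%N) w k.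

Definition cone w : set (cantor n) := range (catw w).

Definition cone_partition t (a : 'I_t -> seq 'I_n) : Prop :=
  trivIset [set: 'I_t] (fun i => cone (a i)) /\
  \bigcup_(i in [set: 'I_t]) cone (a i) = [set: cantor n].

Definition higman_thompson : set (homeo (cantor n)) :=
  [set v | exists t (a b : 'I_t -> seq 'I_n),
    [/\ cone_partition a, cone_partition b &
        forall i u, v (catw (a i) u) = catw (b i) u]].

Lemma nbhs_prefix x m :
  nbhs x [set y : cantor n | forall j, (j < m)%N -> x j = y j].
Proof.
elim: m => [|m IHm]; first by apply: filterS filterT => y _ j.
have hm : nbhs x [set y : cantor n | x m = y m].
  apply: (@proj_continuous nat (fun=> discrete_topology 'I_n) m x
            [set a | x m = a]).
  have h := @discrete_set1 (discrete_topology 'I_n) (x m).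
  by apply: (filterS _ h) => a ->.
apply: filterS (filterI IHm hm) => y [yj ym] j.
by rewrite ltnS leq_eqVlt => /predU1P[->|/yj].
Qed.

Lemma continuous_finite_dep (f : cantor n -> cantor n) :
  (forall k, exists m, forall x y,
      (forall j, (j < m)%N -> x j = y j) -> f x k = f y k) ->
  continuous f.
Proof.
move=> hf x; apply/cvg_sup; first exact/fmap_filter/(@nbhs_filter (cantor n)).
move=> k U [V] [[W] oW <-] Wf WU.
have [m hm] := hf k.
apply: filterS (nbhs_prefix x m) => y xy; apply: WU => /=.
by rewrite -(hm _ _ xy).
Qed.

Lemma coneP w x :
  cone w x <-> forall a k, (k < size w)%N -> x k = nth a w k.
Proof.
split=> [[u _ <-] a k kw|xw]; first exact: set_nth_default.
exists (fun k => x (k + size w)%N) => //; apply/funext => k.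
rewrite /catw; case: (ltnP k (size w)) => kw; first by rewrite -xw.
by rewrite nth_default // subnK.
Qed.

Definition iter_perm_fun w g x : cantor n :=
  fun k => if (x \in cone w) && (size w <= k)%N then g (x k) else x k.

Lemma iter_perm_fun_cone w g x :
  (iter_perm_fun w g x \in cone w) = (x \in cone w).
Proof.
apply/idP/idP => /set_mem/coneP xw; apply/mem_set/coneP => a k kw.
  by rewrite -xw // /iter_perm_fun [(size w <= k)%N]leqNgt kw andbF.
by rewrite /iter_perm_fun [(size w <= k)%N]leqNgt kw andbF; exact: xw.
Qed.

Lemma iter_perm_funK w g : cancel (iter_perm_fun w g) (iter_perm_fun w g^-1).
Proof.
move=> x; apply/funext => k.
rewrite {1}/iter_perm_fun iter_perm_fun_cone /iter_perm_fun.
by case: ifP => [->|->] //; rewrite permK.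
Qed.

Lemma iter_perm_funVK w g : cancel (iter_perm_fun w g^-1) (iter_perm_fun w g).
Proof. by move=> x; rewrite -{1}[g]invgK iter_perm_funK. Qed.

Lemma iter_perm_fun_cts w g : continuous (iter_perm_fun w g).
Proof.
apply: continuous_finite_dep => k; exists (maxn k.+1 (size w)) => x y xy.
have xyk : x k = y k by apply: xy; rewrite leq_max leqnn.
rewrite /iter_perm_fun xyk; congr (if _ && _ then _ else _).
apply/idP/idP => /set_mem/coneP zw; apply/mem_set/coneP => a j jw;
  by rewrite -zw // xy // leq_max jw orbT.
Qed.

Definition iter_perm w g : homeo (cantor n) :=
  @Homeo (cantor n) (iter_perm_fun w g) (iter_perm_fun w g^-1)
    (@iter_perm_funK w g) (@iter_perm_funVK w g)
    (@iter_perm_fun_cts w g) (@iter_perm_fun_cts w g^-1).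

(* [iter_perm_out] and [iter_perm_in] are the defining equations of the iterated
   permutation [w]_g. *)
Lemma iter_perm_out w g x : ~ cone w x -> iter_perm w g x = x.
Proof. by move=> xw; apply/funext => k /=; rewrite /iter_perm_fun memNset. Qed.

Lemma iter_perm_in w g u :
  iter_perm w g (catw w u) = catw w (fun k => g (u k)).
Proof.
apply/funext => k /=; rewrite /iter_perm_fun mem_set /=; last by exists u.
rewrite /catw; case: leqP => kw; first by rewrite !nth_default.
exact: set_nth_default.
Qed.

(* The group V_n(K); [higman_thompson] is V_n as a set of homeomorphisms. *)
Definition higman_thompson_ext (K : {group 'S_n}) : Type :=
  gen_subgroup
    (higman_thompson `|` [set f | exists w g, g \in K /\ f = iter_perm w g]).

HB.instance Definition _ (K : {group 'S_n}) :=
  SubGroup.on (higman_thompson_ext K).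

Definition semiregular_perm (H : {group 'S_n}) : Prop :=
  forall h i, h \in H -> h i = i -> h = 1.

Definition orbit_representatives (H : {group 'S_n}) (R : {set 'I_n}) : Prop :=
  forall i, #|R :&: orbit 'P H i| = 1%N.

End Cantor.

(* Main.v *)
Require Import Defs.
From mathcomp Require Import all_boot all_order all_algebra all_fingroup.
From HB Require Import structures.
From mathcomp Require Import boolp classical_sets topology.

Set Implicit Arguments.
Unset Strict Implicit.
Unset Printing Implicit Defensive.

(* Every letter i is r * h for a unique r in R and a unique offset h in H.
   Record a word x_0 x_1 x_2 ... relative to its own offsets, as
   y_0 = x_0 and y_(k+1) = x_(k+1) * offset(x_k)^-1. In these coordinates the
   letterwise action of h in H only changes y_0, while the letterwise action of
   g in G remains letterwise, because offset(i * g) = offset(i) ^ g. Hence this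
   change of coordinates, a homeomorphism of the Cantor space, conjugates
   V_n(HG) onto V_n(G). Membership in V_n(K) follows from being, on each cone of
   some fixed depth, a prefix replacement followed by a letterwise action of an
   element of K; all the generators are of this form. *)

(** * Prefixes, suffixes and letterwise permutations of infinite words *)

Section Words.
Local Open Scope group_scope.
Variable n : nat.
Implicit Types (a b w : seq 'I_n) (u x : cantor n) (g : 'S_n).

Definition letterwise g u : cantor n := fun k => g (u k).

Lemma letterwiseM g h u : letterwise (g * h) u = letterwise h (letterwise g u).
Proof. by apply/funext => k; rewrite /letterwise permM. Qed.

Lemma letterwise1 u : letterwise 1 u = u.
Proof. by apply/funext => k; rewrite /letterwise perm1. Qed.

Lemma catw_nil u : catw [::] u = u.
Proof. by apply/funext => k; rewrite /catw nth_nil subn0. Qed.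

Lemma catw1S c u k : catw [:: c] u k.+1 = u k.
Proof. by rewrite /catw /= nth_nil subSS subn0. Qed.

Lemma catw_cat a b u : catw (a ++ b) u = catw a (catw b u).
Proof.
apply/funext => k; rewrite /catw nth_cat size_cat subnDA.
case: ltnP => ka; first exact: set_nth_default.
by rewrite [RHS]nth_default.
Qed.

Lemma prefix_catw a u : mkseq (catw a u) (size a) = a.
Proof.
case: a => // c a; apply: (@eq_from_nth _ c); rewrite size_mkseq // => k ka.
by rewrite nth_mkseq //; apply: set_nth_default.
Qed.

Lemma suffix_catw a u : (fun k => catw a u (k + size a)%N) = u.
Proof.
by apply/funext => k; rewrite /catw nth_default ?leq_addl // addnK.
Qed.

Lemma catw_prefix m x : catw (mkseq x m) (fun k => x (k + m)%N) = x.
Proof.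
apply/funext => k; rewrite /catw size_mkseq; case: (ltnP k m) => km.
  by rewrite nth_mkseq.
by rewrite nth_default ?size_mkseq // subnK.
Qed.

Lemma catw_inj a b u v :
  size a = size b -> catw a u = catw b v -> a = b /\ u = v.
Proof.
move=> ab e; split; first by rewrite -(prefix_catw a u) e ab prefix_catw.
by rewrite -(suffix_catw a u) e ab suffix_catw.
Qed.

Lemma iter_perm_catw w g a u : size a = size w ->
  iter_perm w g (catw a u) = catw a (if a == w then letterwise g u else u).
Proof.
move=> aw; case: eqP => [->|naw]; first exact: iter_perm_in.
apply: iter_perm_out => -[v _ e]; apply: naw.
by have [] := catw_inj (esym aw) e.
Qed.

(** Distinct words of equal length have disjoint cones, and every factor preserves each of these
    cones; so at most one factor moves the given point. *)
Lemma prod_iter_perm_catw (kappa : seq 'I_n -> 'S_n) (s : seq (seq 'I_n)) a u :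
    uniq s -> {in s, forall w, size w = size a} ->
  (\prod_(w <- s) iter_perm w (kappa w)) (catw a u) =
    catw a (if a \in s then letterwise (kappa a) u else u).
Proof.
elim: s u => [|w s IHs] u /=; first by rewrite big_nil.
case/andP => ws us sz; rewrite big_cons.
rewrite [LHS](_ : _ = (\prod_(w <- s) iter_perm w (kappa w))
  (iter_perm w (kappa w) (catw a u))) //.
rewrite iter_perm_catw ?sz ?mem_head // IHs // => [|v vs]; last first.
  by rewrite sz // inE vs orbT.
by rewrite inE; case: eqP => [->|_]; rewrite ?(negPf ws).
Qed.

End Words.

(** * Homeomorphisms described cone by cone at a fixed depth *)

Section Exchange.
Local Open Scope classical_set_scope.
Local Open Scope group_scope.
Variable n : nat.
Implicit Types (a b w : seq 'I_n) (u x : cantor n) (K : {group 'S_n}).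

(* Uniform depth [m], instead of an arbitrary cone partition, makes the domain
   partition canonical. *)
Definition exchanges K m (f : cantor n -> cantor n) : Prop :=
  forall a, size a = m ->
    exists b k, k \in K /\ forall u, f (catw a u) = catw b (letterwise k u).

(** Once the depth reaches the longest [a i], each cone of that depth lies in a single piece of the
    domain partition. *)
Lemma higman_thompson_exchanges K (x0 : cantor n) (v : homeo (cantor n)) :
  higman_thompson v -> exists m, exchanges K m v.
Proof.
case=> t [a [b [[_ acov] _ vab]]]; exists (\max_i size (a i))%N => c sc.
(* One sample point suffices to locate the piece, because [c] is at least as long as every [a i]. *)
have : [set: cantor n] (catw c x0) by [].
rewrite -acov => -[i _ [u _ e]].
have le : (size (a i) <= size c)%N by rewrite sc leq_bigmax.
have ec : c = a i ++ drop (size (a i)) c.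
  have : catw (a i) u = catw (take (size (a i)) c)
                             (catw (drop (size (a i)) c) x0).
    by rewrite -catw_cat cat_take_drop -e.
  case/catw_inj; first by rewrite size_takel.
  by move=> eai _; rewrite -{1}(cat_take_drop (size (a i)) c) -eai.
exists (b i ++ drop (size (a i)) c), 1; split=> // y.
by rewrite letterwise1 {1}ec !catw_cat vab.
Qed.

Lemma exchanges_iter_perm K w g : g \in K ->
  exchanges K (size w) (iter_perm w g).
Proof.
move=> gK a aw; exists a, (if a == w then g else 1).
split=> [|u]; first by case: ifP.
by rewrite iter_perm_catw //; case: ifP => // _; rewrite letterwise1.
Qed.

Definition level m : seq (seq 'I_n) := map val (enum {: m.-tuple 'I_n}).

Lemma mem_level m a : (a \in level m) = (size a == m).
Proof.
apply/mapP/idP => [[t _ ->]|am]; first by rewrite size_tuple.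
by exists (Tuple am) => //; rewrite mem_enum.
Qed.

(** With the trivial group only prefix replacement remains. All cones of depth [m] partition the
    domain, and bijectivity of [v] makes their images a partition too. *)
Lemma exchanges_higman_thompson m (v : homeo (cantor n)) :
  exchanges 1 m v -> higman_thompson v.
Proof.
move=> vx.
have /choice [b vb] : forall t : m.-tuple 'I_n, exists b,
    forall u, v (catw t u) = catw b u.
  move=> t; have [|b [k [/set1P-> vb]]] := vx t; first exact: size_tuple.
  by exists b => u; rewrite vb letterwise1.
pose e (i : 'I_#|{: m.-tuple 'I_n}|) : m.-tuple 'I_n := enum_val i.
have coneb i : cone (b (e i)) = v @` cone (e i).
  apply/seteqP; split=> [x [u _ <-]|x [_ [u _ <-] <-]].
    by exists (catw (e i) u) => //; exists u.
  by rewrite vb; exists u.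
have dis i j x : cone (e i) x -> cone (e j) x -> i = j.
  case=> u _ <- [w _ ew]; apply: enum_val_inj; apply: val_inj.
  by have [] := catw_inj _ ew; rewrite ?size_tuple.
have cov x : exists i, cone (e i) x.
  have st : size (mkseq x m) == m by rewrite size_mkseq.
  exists (enum_rank (Tuple st)); rewrite /e enum_rankK.
  by exists (fun k => x (k + m)%N) => //; apply: catw_prefix.
exists #|{: m.-tuple 'I_n}|, (fun i => e i), (fun i => b (e i)).
split=> [||i u]; last exact: vb.
- split; first by move=> i j _ _ [x [xi xj]]; apply: dis xi xj.
  by apply/seteqP; split=> // x _; have [i xi] := cov x; exists i.
- split.
    move=> i j _ _ [x []]; rewrite !coneb => -[y yi <-] [z zj ezy].
    apply: dis yi _; suff -> : y = z by [].
    by rewrite -(homeo_funK v y) -ezy homeo_funK.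
  apply/seteqP; split=> // x _; have [i xi] := cov (homeo_inv v x).
  by exists i => //; rewrite coneb; exists (homeo_inv v x); rewrite ?homeo_invK.
Qed.

End Exchange.

Section Generated.
Local Open Scope classical_set_scope.
Local Open Scope group_scope.
Variables (U : groupType) (S : set U).

Lemma gen_setS f : S f -> f \in gen_set S.
Proof. by move=> Sf; apply/mem_set => A [_ SA]; apply: SA. Qed.

End Generated.

(** * Exchanges and the generators of the extended group *)

Section Extension.
Local Open Scope classical_set_scope.
Local Open Scope group_scope.
Variables (n : nat) (K : {group 'S_n}).

Definition ext_generators : set (homeo (cantor n)) :=
  @higman_thompson n `|` [set f | exists w g, g \in K /\ f = iter_perm w g].

Lemma ext_generators_exchanges (x0 : cantor n) f :
  ext_generators f -> exists m, exchanges K m f.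
Proof.
case=> [/(higman_thompson_exchanges K x0)//|[w [g [gK ->]]]].
by exists (size w); apply: exchanges_iter_perm.
Qed.

(** Precomposing [f] with a product [g] of iterated permutations cancels its letterwise part on
    every cone of depth [m], so [g * f] lies in the Higman-Thompson group. *)
Lemma exchanges_gen_set m (f : homeo (cantor n)) :
  exchanges K m f -> f \in gen_set ext_generators.
Proof.
move=> fx.
have /choice [bk fbk] : forall a : seq 'I_n, exists bk : seq 'I_n * 'S_n,
    size a = m -> bk.2 \in K /\
      forall u, f (catw a u) = catw bk.1 (letterwise bk.2 u).
  move=> a; case: (eqVneq (size a) m) => [/fx[b [k fk]]|/eqP//].
    by exists (b, k).
  by exists ([::], 1).
have closed := gen_set_closed ext_generators.
pose g : homeo (cantor n) := \prod_(a <- level n m) iter_perm a (bk a).2^-1.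
have gx a u : size a = m -> g (catw a u) = catw a (letterwise (bk a).2^-1 u).
  move=> am; rewrite prod_iter_perm_catw ?mem_level ?am ?eqxx //.
    by rewrite map_inj_uniq ?enum_uniq //; apply: val_inj.
  by move=> w; rewrite mem_level => /eqP.
have gG : g \in gen_set ext_generators.
  rewrite /g big_seq; apply: (big_ind (fun h => h \in gen_set ext_generators)).
  - exact: closed.1.
  - exact: (group_closedM closed).
  move=> a; rewrite mem_level => /eqP/fbk[kK _]; apply: gen_setS; right.
  by exists a, (bk a).2^-1; rewrite groupV.
have gfG : g * f \in gen_set ext_generators.
  apply: gen_setS; left; apply: (@exchanges_higman_thompson _ m) => a am.
  exists (bk a).1, 1; split=> // u.
  rewrite [LHS](_ : _ = f (g (catw a u))) // gx //.
  by have [_ ->] := fbk a am; rewrite -letterwiseM mulVg.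
rewrite -(mulKg g f); apply: (group_closedM closed) => //.
exact: (group_closedV closed).
Qed.

End Extension.

(** * Offsets from the representatives and the change of coordinates *)

Section Offset.
Local Open Scope group_scope.
Variables (n : nat) (H G : {group 'S_n}) (R : {set 'I_n}).
Hypotheses (hH : semiregular_perm H) (hR : orbit_representatives H R).
Hypothesis hG : G \subset 'N(H) :&: 'N(R | 'P).

(** The default [1] is never reached, since every orbit meets [R]. *)
Definition offset (i : 'I_n) : 'S_n :=
  odflt 1 [pick h in H | h^-1 i \in R].

Lemma offsetP i : offset i \in H /\ (offset i)^-1 i \in R.
Proof.
rewrite /offset; case: pickP => [h /andP[]//|noh].
have /eqP/cards1P[r er] := hR i.
have /setIP[rR /orbitP[h hH' ehr]] : r \in R :&: orbit 'P H i.
  by rewrite er set11.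
by have := noh h^-1; rewrite groupV hH' invgK -[h i]/(aperm i h) ehr rR.
Qed.

(** Both [h^-1 i] and [(offset i)^-1 i] are the one representative in the orbit of [i], so
    [h^-1 * offset i] fixes [i] and semiregularity applies. *)
Lemma offset_unique h i : h \in H -> h^-1 i \in R -> offset i = h.
Proof.
move=> hin hiR; have [oH oR] := offsetP i.
have /eqP/cards1P[r er] := hR i.
have in1 k : k \in H -> k^-1 i \in R -> k^-1 i = r.
  move=> kH kR; apply/set1P; rewrite -er inE kR /=.
  by apply/orbitP; exists k^-1; rewrite ?groupV.
apply/eqP; rewrite eq_sym eq_mulVg1; apply/eqP; apply: (hH (i := i)).
  by rewrite groupM ?groupV.
by rewrite permM (in1 h) // -(in1 (offset i)) // permKV.
Qed.

Lemma offset_mul h i : h \in H -> offset (h i) = offset i * h.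
Proof.
move=> hin; have [oH oR] := offsetP i.
apply: offset_unique; first exact: groupM.
by rewrite invMg permM permK.
Qed.

(** Normalizing [H] keeps the conjugate in [H]; stabilizing [R] sends the representative of [i] to
    one of [g i]. Uniqueness concludes. *)
Lemma offset_conj g i : g \in G -> offset (g i) = offset i ^ g.
Proof.
move=> gG; have [oH oR] := offsetP i.
have /setIP[gN gR] := fintype.subsetP hG _ gG.
apply: offset_unique; first by rewrite memJ_norm.
rewrite -conjVg conjgE !permM permK.
by rewrite -[g _]/('P%act _ g) (astabs_act _ gR).
Qed.

(* [differ s x] records each letter relative to the offset of the preceding one,
   [s] playing the role of the offset before the first letter. *)
Definition differ (s : 'S_n) (x : cantor n) : cantor n :=
  fun k => (if k is j.+1 then offset (x j) else s)^-1 (x k).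

Fixpoint integral_state (s : 'S_n) (y : cantor n) k : 'S_n :=
  if k is j.+1 then offset (integral_state s y j (y j)) else s.

Definition integrate (s : 'S_n) (y : cantor n) : cantor n :=
  fun k => integral_state s y k (y k).

Lemma differK s : cancel (differ s) (integrate s).
Proof.
move=> x; apply/funext => k; rewrite /integrate.
rewrite (_ : integral_state _ _ k = if k is j.+1 then offset (x j) else s).
  exact: permKV.
by elim: k => //= k ->; rewrite /differ permKV.
Qed.

Lemma integrateK s : cancel (integrate s) (differ s).
Proof. by move=> y; apply/funext => -[|k]; exact: permK. Qed.

Lemma differ_cts s : continuous (differ s).
Proof.
apply: continuous_finite_dep => k; exists k.+1 => x y xy.
rewrite /differ (xy k) //; case: k xy => // k xy.
by rewrite (xy k).
Qed.

Lemma integrate_cts s : continuous (integrate s).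
Proof.
apply: continuous_finite_dep => k; exists k.+1 => x y xy.
rewrite /integrate (xy k) //; congr (fun_of_perm _ _).
elim: k xy => //= k IHk xy.
by rewrite IHk => [|j jk]; rewrite xy // ltnW.
Qed.

Definition differ_homeo : homeo (cantor n) :=
  Homeo (differK 1) (integrateK 1) (@differ_cts 1) (@integrate_cts 1).

Fixpoint differw (s : 'S_n) (a : seq 'I_n) : seq 'I_n :=
  if a is c :: a' then s^-1 c :: differw (offset c) a' else [::].

Fixpoint integratew (s : 'S_n) (b : seq 'I_n) : seq 'I_n :=
  if b is c :: b' then s c :: integratew (offset (s c)) b' else [::].

Lemma integratewK s : cancel (integratew s) (differw s).
Proof. by move=> b; elim: b s => //= c b IHb s; rewrite permK IHb. Qed.

Lemma size_differw s a : size (differw s a) = size a.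
Proof. by elim: a s => //= c a IHa s; rewrite IHa. Qed.

Lemma size_integratew s b : size (integratew s b) = size b.
Proof. by rewrite -{2}(integratewK s b) size_differw. Qed.

(** The state in which [differ 1] is left after reading [a]; the default [1] is the initial state,
    for the empty word. *)
Definition last_offset (a : seq 'I_n) : 'S_n := last 1 (map offset a).

Lemma last_offset_in a : last_offset a \in H.
Proof.
rewrite /last_offset; case/lastP: a => [|a c]; first exact: group1.
by rewrite map_rcons last_rcons; case: (offsetP c).
Qed.

Lemma differ_catw a u :
  differ 1 (catw a u) = catw (differw 1 a) (differ (last_offset a) u).
Proof.
(* The initial state and the default of [last] are generalized together, as both become [offset c]
   after one letter. *)
rewrite /last_offset; elim: a 1 u => [|c a IHa] s u.
  by rewrite /= !catw_nil.
have cons_catw d b v : catw (d :: b) v = catw [:: d] (catw b v).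
  by rewrite -catw_cat.
rewrite /= cons_catw [RHS]cons_catw -IHa.
by apply/funext => -[|[|k]]; rewrite /differ ?catw1S.
Qed.

(** By [offset_mul], [h] cancels between consecutive letters and survives only at the first one. *)
Lemma differ_letterwiseH s h u : h \in H ->
  differ s (letterwise h u) = differ (s * h^-1) u.
Proof.
move=> hin; apply/funext => -[|k]; rewrite /differ /letterwise.
  by rewrite invMg invgK permM.
by rewrite offset_mul // invMg permM permK.
Qed.

Lemma differ_letterwiseG g u : g \in G ->
  differ 1 (letterwise g u) = letterwise g (differ 1 u).
Proof.
move=> gG; apply/funext => -[|k]; rewrite /differ /letterwise.
  by rewrite invg1 !perm1.
by rewrite offset_conj // -conjVg conjgE !permM permK.
Qed.

Lemma differ_letterwise_first h c u v : h \in H -> differ 1 u = catw [:: c] v ->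
  differ 1 (letterwise h u) = catw [:: h c] v.
Proof.
move=> hin uc; rewrite differ_letterwiseH // mul1g.
apply/funext => -[|k]; last by rewrite catw1S -(catw1S c v) -uc.
have := congr1 (@^~ 0%N) uc; rewrite /differ /catw /= invg1 perm1 => ->.
by rewrite invgK.
Qed.

(** Trades the state [s] for a letterwise action, returning to state [1], where [differ_letterwiseG]
    applies. *)
Lemma differ_letterwise_mulV s u : s \in H ->
  differ s u = differ 1 (letterwise s^-1 u).
Proof. by move=> sH; rewrite differ_letterwiseH ?groupV // invgK mul1g. Qed.

(** * Conjugating exchanges by the change of coordinates *)

Variable HG : {group 'S_n}.
Hypothesis defHG : (HG : {set 'S_n}) = H * G.

Lemma last_offset_HG a : last_offset a \in HG.
Proof. by rewrite defHG -[last_offset a]mulg1 mem_mulg ?last_offset_in. Qed.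

Lemma exchanges_conj_differ m (f : homeo (cantor n)) :
  exchanges HG m f -> exchanges G m.+1 (f ^ differ_homeo).
Proof.
move=> fx d; case/lastP: d => // a' c; rewrite size_rcons => -[am].
have [|b [k [kHG fk]]] := fx (integratew 1 a').
  by rewrite size_integratew.
set a := integratew 1 a' in fk.
pose p := last_offset a; pose q := last_offset b.
have /mulsgP[h g hin gG epq] : p * k * q^-1 \in H * G.
  by rewrite -defHG !groupM ?groupV ?last_offset_HG.
(* The extra letter [c] absorbs [h], which alters only the first letter after the prefix; this is
   why the depth grows by one. *)
exists (rcons (differw 1 b) (g (h c))), g; split=> // v.
pose u := integrate p (catw [:: c] v).
have differ_u : differ p u = catw [:: c] v by exact: integrateK.
have -> : catw (rcons a' c) v = differ_homeo (catw a u).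
  by rewrite /= differ_catw integratewK differ_u -catw_cat cats1.
rewrite [LHS](_ : _ = differ 1 (f (catw a u))); last first.
  by rewrite /= (differK 1).
rewrite fk differ_catw -cats1 catw_cat; congr (catw _ _).
rewrite -/q differ_letterwise_mulV ?last_offset_in // -letterwiseM.
rewrite (_ : k * q^-1 = p^-1 * h * g); last first.
  by rewrite -mulgA -epq !mulgA mulVg mul1g.
rewrite !letterwiseM differ_letterwiseG //.
rewrite (differ_letterwise_first (c := c) (v := v)) //.
  by apply/funext => -[|j]; rewrite /letterwise ?catw1S.
by rewrite -differ_letterwise_mulV ?last_offset_in.
Qed.

Lemma exchanges_conj_differV m (f : homeo (cantor n)) :
  exchanges G m f -> exchanges HG m (f ^ differ_homeo^-1).
Proof.
move=> fx a am; have [|b' [g [gG fg]]] := fx (differw 1 a).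
  by rewrite size_differw.
set b := integratew 1 b'; pose p := last_offset a; pose q := last_offset b.
(* The factor [p^-1] resets the state left by [a] to [1], where [g] commutes with [differ]; [q] then
   compensates for the state left by [b]. *)
exists b, (p^-1 * g * q); split=> [|u].
  rewrite !groupM ?groupV ?last_offset_HG //.
  by apply: fintype.subsetP gG; rewrite defHG mulG_subr.
apply: (can_inj (differK 1)).
rewrite [LHS](_ : _ = f (differ 1 (catw a u))); last first.
  by rewrite conjgE invgK /= (integrateK 1).
rewrite !differ_catw fg integratewK; congr (catw _ _).
rewrite -/p -/q [RHS]differ_letterwise_mulV ?last_offset_in //.
rewrite -letterwiseM mulgK letterwiseM differ_letterwiseG //.
by rewrite -differ_letterwise_mulV ?last_offset_in.
Qed.

End Offset.

(** * Conjugation as a morphism between generated subgroups *)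

Section ConjugateGenerated.
Local Open Scope classical_set_scope.
Local Open Scope group_scope.
Variables (U : groupType) (S T : set U) (z : U).
Hypothesis STz : forall f, S f -> f ^ z \in gen_set T.

(** The elements whose conjugate by [z] lies in [gen_set T] form a subgroup containing [S];
    minimality of [gen_set S] does the rest. *)
Lemma gen_set_conj f : f \in gen_set S -> f ^ z \in gen_set T.
Proof.
move=> /set_mem fS.
have [T1 Tdiv] := gen_set_closed T.
have closedTz : group_closed (fun g => g \in [set g | g ^ z \in gen_set T]).
  split=> [|g h]; rewrite !inE /= ?conj1g // conjMg conjVg; exact: Tdiv.
exact: (fS _ (conj closedTz STz)).
Qed.

Definition gen_conj (f : gen_subgroup S) : gen_subgroup T :=
  Sub (val f ^ z) (gen_set_conj (valP f)).

Fact gen_conjM : {morph gen_conj : f g / f * g}.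
Proof. by move=> f g; apply: val_inj; rewrite /= conjMg. Qed.

HB.instance Definition _ := isMultiplicative.Build _ _ gen_conj gen_conjM.

End ConjugateGenerated.

Theorem theorem2 (n : nat) (H G : {group 'S_n}) (R : {set 'I_n})
    (hn : (2 <= n)%N)
    (hH : semiregular_perm H)
    (hR : orbit_representatives H R)
    (hG : (G \subset 'N(H) :&: 'N(R | 'P))%g) :
  exists HG : {group 'S_n},
    (HG : {set 'S_n}) = (H * G)%g /\
    exists f : {multiplicative higman_thompson_ext HG -> higman_thompson_ext G},
      bijective f.
Proof.
have defHG : (H <*> G)%G = (H * G)%g :> {set 'S_n}.
  apply: norm_joinEr; apply: fintype.subset_trans hG _; exact: finset.subsetIl.
exists (H <*> G)%G; split=> //.
have x0 : cantor n := fun=> Ordinal (ltnW hn).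
pose phi := differ_homeo H R.
have conj_in f : ext_generators (H <*> G)%G f ->
    (f ^ phi)%g \in gen_set (ext_generators G).
  case/(ext_generators_exchanges x0) => m fm.
  by apply: exchanges_gen_set; apply: exchanges_conj_differ fm.
have conjV_in f : ext_generators G f ->
    (f ^ phi^-1)%g \in gen_set (ext_generators (H <*> G)%G).
  case/(ext_generators_exchanges x0) => m fm.
  by apply: exchanges_gen_set; apply: exchanges_conj_differV fm.
exists (gen_conj conj_in); exists (gen_conj conjV_in) => f; apply: val_inj.
  exact: conjgK.
exact: conjgKV.
Qed.
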